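(* Let $2<q<\infty$. Then the real space $\ell_q$ has no Hilbert-Schauder frame $\{x_n,f_n\}_{n\in\mathbb{N}}$ with $\liminf_{n}\|f_n\|>0$.
   Context: All Banach spaces are over the real scalars. For a Banach space $X$, a sequence of pairs $\{x_n,f_n\}_{n\in\mathbb{N}}$ in $X\times X^*$ is a Schauder frame of $X$ if $x=\sum_n f_n(x)x_n$ (norm convergence, in the given order) for every $x\in X$. A Schauder frame $\{x_n,f_n\}$ of a separable Banach space $X$ is a Hilbert-Schauder frame (HS-frame) if there is a bounded linear operator $S:X\to X^*$ with $S(x_n)=f_n$ for all $n$. *)

(* Defs.v *)
From HB Require Import structures.
From mathcomp Require Import all_boot all_order all_algebra.
From mathcomp Require Import all_classical all_reals all_analysis.
Import Order.TTheory GRing.Theory Num.Theory.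
Import numFieldNormedType.Exports.

Set Implicit Arguments.
Unset Strict Implicit.
Unset Printing Implicit Defensive.

Local Open Scope classical_set_scope.
Local Open Scope ring_scope.

(* As every function on nat is measurable and only the empty set is null for
   the counting measure, L^q(counting) needs no quotient by a.e. equality. *)
Section ell.
Context (R : realType) (q : R) (q1 : (1 <= q%:E)%E).

Definition ell : Type := LfunType (@counting nat R) q1.

HB.instance Definition _ := GRing.Lmodule.on ell.

Definition ell_fun (u : ell) : nat -> R := u.

Definition ell_norm (u : ell) : R := fine ('N[counting]_q%:E [EFin \o u])%E.

Let q0 : 0 < q.
Proof. by rewrite (lt_le_trans ltr01)// -lee_fin. Qed.

Lemma ell_normE (u : ell) :
  ((ell_norm u)%:E = (\sum_(k <oo) (`|ell_fun u k| `^ q)%:E) `^ q^-1)%E.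
Proof. by rewrite finite_norm_fine Lnorm_counting. Qed.

Lemma ell_normD (u v : ell) : ell_norm (u + v) <= ell_norm u + ell_norm v.
Proof. exact: ler_LnormD. Qed.

Lemma ell_normZ (a : R) (u : ell) : ell_norm (a *: u) = `|a| * ell_norm u.
Proof. by apply/EFin_inj; rewrite finite_norm_fine LnormZ EFinM finite_norm_fine. Qed.

Lemma ell_norm_eq0 (u : ell) : ell_norm u = 0 -> u = 0.
Proof.
move=> u0; apply/LfuneqP => k; have /esym/eqP := ell_normE u.
have ge0 n : (0 <= (`|ell_fun u n| `^ q)%:E)%E by rewrite lee_fin powR_ge0.
rewrite u0 poweR_eq0 ?nneseries_ge0// => /andP[/eqP + _].
rewrite (nneseriesD1 (n := k))// => /eqP.
rewrite padde_eq0 ?nneseries_ge0// => /andP[+ _].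
by rewrite eqe powR_eq0 normr_eq0 => /andP[/eqP].
Qed.

HB.instance Definition _ :=
  @Lmodule_isNormed.Build R ell ell_norm ell_normD ell_normZ ell_norm_eq0.

End ell.

Section dual.
Context (R : realType) (X : normedModType R).

Definition in_dual : {pred (X -> R^o)} :=
  fun f => `[< linear f /\ continuous f >].

Lemma in_dual_submod_closed : submod_closed in_dual.
Proof.
split=> [|a f g /asboolP[lf cf] /asboolP[lg cg]]; apply/asboolP; split.
- by move=> a x y /=; rewrite scaler0 addr0.
- exact: cst_continuous.
- by move=> b x y; rewrite !fctE lf lg !scalerDr !scalerA [b * a]mulrC addrACA.
- by move=> x; exact: cvgD (cvgZl_tmp (k := a) (cf x)) (cg x).
Qed.

HB.instance Definition _ :=
  GRing.isSubmodClosed.Build R (X -> R^o) in_dual in_dual_submod_closed.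

Record dual := Dual { dual_fun :> X -> R^o; _ : dual_fun \in in_dual }.

HB.instance Definition _ := [isSub of dual for dual_fun].
HB.instance Definition _ := [Choice of dual by <:].
HB.instance Definition _ := [SubChoice_isSubLmodule of dual by <:].

Definition dual_norm (f : dual) : R :=
  sup [set `|f x| | x in [set x : X | `|x| <= 1]].

Lemma dual_linear (f : dual) : linear f.
Proof. by case: f => f /= /asboolP[]. Qed.

Lemma dual_continuous (f : dual) : continuous f.
Proof. by case: f => f /= /asboolP[]. Qed.

HB.instance Definition _ (f : dual) :=
  GRing.isLinear.Build R X R^o *:%R (dual_fun f) (dual_linear f).

Lemma dual_has_sup (f : dual) :
  has_sup [set `|f x| | x in [set x : X | `|x| <= 1]].
Proof.
split; first by exists `|f 0|; exists 0 => //=; rewrite normr0.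
have /bounded_funP/(_ 1)[M fM] : bounded_near (dual_fun f) (nbhs (0 : X)).
  exact/linear_bounded_continuous/dual_continuous.
by exists M => _ [x x1 <-]; exact: fM.
Qed.

Lemma dual_norm_ge (f : dual) (x : X) : `|x| <= 1 -> `|f x| <= dual_norm f.
Proof.
by move=> x1; apply: ub_le_sup; [case: (dual_has_sup f)|exists x].
Qed.

Lemma dual_norm_le (f : dual) (M : R) :
  (forall x, `|x| <= 1 -> `|f x| <= M) -> dual_norm f <= M.
Proof.
move=> fM; apply: ge_sup; first by case: (dual_has_sup f).
by move=> _ [x x1 <-]; exact: fM.
Qed.

Lemma dual_normD (f g : dual) : dual_norm (f + g) <= dual_norm f + dual_norm g.
Proof.
apply: dual_norm_le => x x1; apply: le_trans (ler_normD _ _) _.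
by rewrite lerD// dual_norm_ge.
Qed.

Lemma dual_norm_eq0 (f : dual) : dual_norm f = 0 -> f = 0.
Proof.
move=> f0; apply/val_inj/funext => x /=.
have [->|x0] := eqVneq x 0; first by rewrite linear0.
have xx : x = `|x| *: (`|x|^-1 *: x).
  by rewrite scalerA divff ?normr_eq0// scale1r.
have : `|f (`|x|^-1 *: x)| <= 0.
  rewrite -f0; apply: dual_norm_ge.
  by rewrite normrZ normfV normr_id mulVf// normr_eq0.
by rewrite normr_le0 => /eqP fx0; rewrite xx linearZ/= fx0 scaler0.
Qed.

Lemma dual_normZ (a : R) (f : dual) : dual_norm (a *: f) = `|a| * dual_norm f.
Proof.
have le b g : dual_norm (b *: g) <= `|b| * dual_norm g.
  apply: dual_norm_le => x x1; rewrite /= normrZ.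
  by rewrite ler_wpM2l// dual_norm_ge.
apply/eqP; rewrite eq_le le/=; have [->|a0] := eqVneq a 0.
  rewrite normr0 mul0r scale0r.
  by apply: le_trans (dual_norm_ge 0 (_ : `|0| <= 1)); rewrite ?normr0.
rewrite -ler_pdivlMl ?normr_gt0// -normfV.
by apply: le_trans (le _ _); rewrite scalerA mulVf// scale1r.
Qed.

HB.instance Definition _ :=
  @Lmodule_isNormed.Build R dual dual_norm dual_normD dual_normZ dual_norm_eq0.

End dual.

Section frames.
Context (R : realType) (X : normedModType R).

Definition schauder_frame (x : nat -> X) (f : nat -> dual X) :=
  forall y : X, series (fun n => f n y *: x n) @ \oo --> y.

Definition bounded_operator (Y : normedModType R) (S : X -> Y) :=
  exists M : R, forall x : X, `|S x| <= M * `|x|.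

Definition HS_frame (x : nat -> X) (f : nat -> dual X) :=
  schauder_frame x f /\
  exists S : {linear X -> dual X},
    bounded_operator S /\ forall n, S (x n) = f n.

End frames.

Lemma gt2_ge1 (R : realType) (q : R) : 2 < q -> (1 <= q%:E)%E.
Proof. by rewrite lee_fin => /ltW; apply: le_trans; rewrite ler1n. Qed.

(* Main.v *)
(* An HS-frame turns S into a bounded, symmetric, positive semidefinite form,
   S y z = sum_n f_n(y) f_n(z), so f_n -> 0 pointwise and, by Cauchy-Schwarz,
   |f_n|^2 <= |S| S(x_n, x_n).  By uniform boundedness (l_q is complete),
   |f_n| |x_n| is bounded, hence so is (x_n) if |f_n| is bounded below.  As in
   Pitt's theorem, for q > 2 such a form is small on vectors supported far out:
   otherwise N normalized disjoint blocks, with signs making the cross terms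
   nonnegative, have a sum w with S(w, w) >= cN while |w|^2 <= N^(2/q).  So
   S(x_n, x_n) is controlled by the pairings f_n(e_i), for finitely many i, and
   tends to 0; hence so does |f_n|. *)
Require Import Defs.
From HB Require Import structures.
From mathcomp Require Import all_boot all_order all_algebra.
From mathcomp Require Import all_classical all_reals all_analysis.
From mathcomp Require Import ring lra.
Import Order.TTheory GRing.Theory Num.Theory.
Import numFieldNormedType.Exports.

Local Open Scope classical_set_scope.
Local Open Scope ring_scope.

(** * Coordinates, truncations and completeness of $\ell_q$ *)

Section ell_theory.
Context {R : realType} {q : R} {q1 : (1 <= q%:E)%E}.
Implicit Types (u v : ell q1) (w : nat -> R) (e : R).

Lemma ell_exp_gt0 : 0 < q.
Proof. by rewrite (lt_le_trans ltr01)// -lee_fin. Qed.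

Lemma ell_norm_powR u : ((`|u| `^ q)%:E = \sum_(k <oo) (`|u k| `^ q)%:E)%E.
Proof.
have q0 := ell_exp_gt0.
rewrite -poweR_EFin ell_normE -poweRrM mulVf ?gt_eqF// poweRe1//.
by apply: nneseries_ge0 => n _ _; rewrite lee_fin powR_ge0.
Qed.

(** Trades the extended-real series for finite real sums; all later norm estimates in $\ell_q$ go
    through these partial sums. *)
Lemma ell_normP u e : 0 <= e ->
  (`|u| <= e) <-> (forall n, \sum_(i < n) `|u i| `^ q <= e `^ q).
Proof.
move=> e0; have q0 := ell_exp_gt0; split=> [ue n|ue].
  apply: (@le_trans _ _ (`|u| `^ q)); last first.
    by apply: ge0_ler_powR => //; rewrite ?nnegrE// ltW.
  rewrite -lee_fin ell_norm_powR -sumEFin -(big_mkord xpredT (fun k => (`|u k| `^ q)%:E)).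
  by apply: nneseries_lim_ge => k _ _; rewrite lee_fin powR_ge0.
rewrite leNgt; apply/negP => eu.
have : e `^ q < `|u| `^ q by apply: gt0_ltr_powR => //; rewrite nnegrE.
apply/negP; rewrite -leNgt -lee_fin ell_norm_powR.
apply: lime_le; first by apply: is_cvg_nneseries => n _ _; rewrite lee_fin powR_ge0.
by apply: nearW => n; rewrite sumEFin lee_fin big_mkord.
Qed.

Lemma ell_of_bounded w e :
  (forall n, \sum_(i < n) `|w i| `^ q <= e) -> {u : ell q1 | forall i, u i = w i}.
Proof.
move=> we; have q0 := ell_exp_gt0.
have wL : w \in Lfun (@counting nat R) q%:E.
  rewrite inE/=; apply/andP; split; rewrite inE//=.
  rewrite /finite_norm Lnorm_counting// poweR_lty//.
  apply: le_lt_trans (ltry e); apply: lime_le.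
    by apply: is_cvg_nneseries => n _ _; rewrite poweR_ge0.
  by apply: nearW => n; rewrite sumEFin lee_fin big_mkord.
by exists (Lfun_Sub q1 wL) => i; exact: (congr1 (@^~ i) (Lfun_valP q1 wL)).
Qed.

Lemma ell_coordD u v i : (u + v) i = u i + v i. Proof. by []. Qed.
Lemma ell_coordN u i : (- u) i = - u i. Proof. by []. Qed.
Lemma ell_coordZ e u i : (e *: u) i = e * u i. Proof. by []. Qed.
Lemma ell_coord0 i : (0 : ell q1) i = 0. Proof. by []. Qed.

Lemma ell_coord_le u i : `|u i| <= `|u|.
Proof.
have q0 := ell_exp_gt0.
have := (ell_normP u _ (normr_ge0 u)).1 (lexx _) i.+1.
rewrite big_ord_recr/= [X in _ -> is_true X]leNgt; apply: contraTN => ui; rewrite -ltNge.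
apply: (@lt_le_trans _ _ (`|u i| `^ q)).
  by apply: gt0_ltr_powR => //; rewrite nnegrE.
by rewrite lerDr sumr_ge0// => j _; exact: powR_ge0.
Qed.

Lemma ell_unit_bounded (k n : nat) :
  \sum_(i < n) `|(val i == k)%:R : R| `^ q <= 1.
Proof.
have [kn|nk] := ltnP k n; last first.
  rewrite big1// => i _; rewrite ltn_eqF ?(leq_trans _ nk)//= normr0.
  by rewrite powR0// gt_eqF ?ell_exp_gt0.
rewrite (bigD1 (Ordinal kn))//= eqxx normr1 powR1 big1 ?addr0// => i.
rewrite -val_eqE/= => /negPf ->.
by rewrite normr0 powR0// gt_eqF ?ell_exp_gt0.
Qed.

Definition ell_unit (k : nat) : ell q1 :=
  sval (ell_of_bounded (fun i => (i == k)%:R) 1 (ell_unit_bounded k)).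

Lemma ell_unitE k i : ell_unit k i = (i == k)%:R.
Proof. exact: (svalP (ell_of_bounded (fun i => (i == k)%:R) 1 _)). Qed.

Lemma ell_unit_norm k : `|ell_unit k| <= 1.
Proof.
apply/ell_normP => // n; rewrite powR1.
by under eq_bigr do rewrite ell_unitE; exact: ell_unit_bounded.
Qed.

(** The argument is an arbitrary sequence, so that truncation also applies to a coordinatewise limit
    not yet known to lie in $\ell_q$. *)
Definition ell_head n w : ell q1 := \sum_(k < n) w k *: ell_unit k.

Lemma ell_headE n w i : ell_head n w i = if (i < n)%N then w i else 0.
Proof.
rewrite /ell_head; elim: n => [|n ih]; first by rewrite big_ord0.
rewrite big_ord_recr ell_coordD ih ell_coordZ ell_unitE/=.
have [->|ni] := eqVneq i n; first by rewrite ltnn add0r mulr1 ltnSn.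
have -> : (i < n.+1)%N = (i < n)%N by rewrite ltnS leq_eqVlt (negPf ni).
by rewrite mulr0 addr0.
Qed.

Lemma ell_head_norm n w : `|ell_head n w| <= \sum_(k < n) `|w k|.
Proof.
apply: le_trans (ler_norm_sum _ _ _) _; apply: ler_sum => k _.
by rewrite normrZ ler_piMr// ell_unit_norm.
Qed.

Lemma ell_head_le n u : `|ell_head n u| <= `|u|.
Proof.
apply/ell_normP => // m.
apply: le_trans ((ell_normP u _ (normr_ge0 _)).1 (lexx _) m).
apply: ler_sum => i _; rewrite ell_headE; case: ifP => // _.
by rewrite normr0 powR0 ?powR_ge0// gt_eqF ?ell_exp_gt0.
Qed.

Lemma ell_of_head w e : 0 <= e -> (forall n, `|ell_head n w| <= e) ->
  {u : ell q1 | (forall i, u i = w i) & `|u| <= e}.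
Proof.
move=> e0 we.
have wE n : \sum_(i < n) `|w i| `^ q <= e `^ q.
  apply: le_trans ((ell_normP _ _ e0).1 (we n) n).
  by apply: ler_sum => i _; rewrite ell_headE ltn_ord.
have [u uw] := ell_of_bounded _ _ wE; exists u => //.
by apply/ell_normP => // n; under eq_bigr do rewrite uw.
Qed.

(** Coordinates are 1-Lipschitz, so a Cauchy filter has a coordinatewise limit; uniform bounds on
    truncations upgrade this to norm convergence. Completeness is what uniform boundedness will
    require. *)
Lemma ell_complete (F : set_system (ell q1)) :
  ProperFilter F -> cauchy F -> cvg F.
Proof.
move=> FF /cauchy_ballP Fc.
pose l i : R := lim ((fun u : ell q1 => u i) @ F).
have lE i : (fun u : ell q1 => u i) @ F --> l i.
  apply: (@cauchy_cvg R (fmap (fun u : ell q1 => u i) F)).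
  apply/cauchy_ballP => e e0; rewrite /= !near_map2.
  have := Fc e e0; rewrite !near_simpl.
  apply: filterS => -[u v] /=; rewrite -!ball_normE/=.
  exact: le_lt_trans (ell_coord_le (u - v) i).
(* Compare [u] with a [v] in the filter that is [e]-close to [u] in norm and [d]-close to [l] on the
   first [n] coordinates, then let [d] tend to 0. *)
have head_le (e : R) : 0 < e ->
    \forall u \near F, forall n, `|ell_head n (fun i => (u : ell q1) i - l i)| <= e.
  move=> e0; have [[U V] [/= FU FV] UV] := Fc _ e0.
  apply: (filterS _ FU) => u Uu n; apply/ler_addgt0Pr => d d0.
  have : \forall v \near F, \sum_(k < n) `|(v : ell q1) k - l k| < d.
    have sum0 : (fun v : ell q1 => \sum_(k < n) `|v k - l k|) @ F --> (0 : R).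
      rewrite [X in _ --> X](_ : _ = \sum_(k < n) `|l k - l k|); last first.
        by rewrite big1// => k _; rewrite subrr normr0.
      apply: cvg_big => [|k _]; first exact: add_continuous.
      by apply: cvg_norm; apply: cvgB (lE k) (cvg_cst _).
    apply: (filterS _ (cvgr0_norm_lt _ sum0 _ d0)) => v /=.
    by rewrite ger0_norm// sumr_ge0.
  move=> Fd; have [v [Vv vd]] := filter_ex (filterI FV Fd).
  have -> : ell_head n (fun i => u i - l i) =
      ell_head n (u - v : ell q1) + ell_head n (fun i => v i - l i).
    rewrite -big_split/=; apply: eq_bigr => k _.
    by rewrite -scalerDl !fctE addrA subrK.
  apply: le_trans (ler_normD _ _) (lerD _ _).
    apply: le_trans (ell_head_le _ _) _; apply: ltW.
    by have := UV (u, v) (conj Uu Vv); rewrite /= -ball_normE.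
  exact: le_trans (ell_head_norm _ _) (ltW vd).
(* [w] has the coordinates of [u0 - l], so [u0 - w] is an element of $\ell_q$ with coordinates
   [l]. *)
have [u0 u0l] := filter_ex (head_le 1 ltr01).
have [w wE _] := ell_of_head _ _ ler01 u0l.
apply/cvg_ex; exists (u0 - w); apply/cvgrPdist_le => e e0.
apply: filterS (head_le e e0) => u ul.
have [v vE ve] := ell_of_head _ _ (ltW e0) ul.
rewrite distrC (_ : u - _ = v)//; apply/LfuneqP => i.
rewrite ell_coordD ell_coordN ell_coordD ell_coordN wE vE.
by rewrite subKr.
Qed.

HB.instance Definition _ := Uniform_isComplete.Build (ell q1) ell_complete.

End ell_theory.

(** * Tails of vectors in $\ell_q$ *)

Section ell_tail.
Context {R : realType} {q : R} {q1 : (1 <= q%:E)%E}.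
Implicit Types u : ell q1.

Lemma ell_tailE u n i : (u - ell_head n u) i = if (i < n)%N then 0 else u i.
Proof.
rewrite ell_coordD ell_coordN ell_headE.
by case: ifP => _; rewrite ?subrr ?subr0.
Qed.

Lemma ell_tail_le u n : `|u - ell_head n u| <= `|u|.
Proof.
apply/ell_normP => // m.
apply: le_trans ((ell_normP u _ (normr_ge0 _)).1 (lexx _) m).
apply: ler_sum => i _; rewrite ell_tailE; case: ifP => // _.
by rewrite normr0 powR0 ?powR_ge0// gt_eqF ?(@ell_exp_gt0 _ _ q1).
Qed.

Lemma ell_head_cvg u (e : R) : 0 < e -> exists n, `|u - ell_head n u| <= e.
Proof.
move=> e0; have q0 := @ell_exp_gt0 _ _ q1.
pose s n := \sum_(i < n) `|u i| `^ q.
have s_sup : has_sup (range s).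
  split; first by exists (s 0%N), 0%N.
  by exists (`|u| `^ q) => _ [n _ <-]; exact: (ell_normP u _ _).1.
(* Past a partial sum within [e]^ q[of the supremum, no block of further terms can add more than]e
   [^ q]. *)
have [_ [N _ <-] sN] := sup_adherent (powR_gt0 q e0) s_sup.
exists N; move: (u - _) (ell_tailE u N) => t tailE.
apply/ell_normP => [|n]; first exact: ltW.
apply: (@le_trans _ _ (\sum_(i < N + n) `|t i| `^ q)).
  rewrite addnC big_split_ord/= lerDl sumr_ge0// => i _; exact: powR_ge0.
have : s (N + n)%N <= sup (range s) by apply: ub_le_sup s_sup.2 _ _; exists (N + n)%N.
rewrite {1}/s big_split_ord/= -/(s N) => sNn.
rewrite big_split_ord/= big1 => [|i _]; last first.
  by rewrite tailE ltn_ord normr0 powR0// gt_eqF.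
rewrite add0r; under eq_bigr do rewrite tailE ltnNge leq_addr/=.
by lra.
Qed.

End ell_tail.

(** * The bilinear form $(x,y)\mapsto S(x)(y)$ *)

Section quadratic_form.
Context {R : realType} {X : normedModType R} (S : {linear X -> dual X}).
Implicit Types x y : X.

Lemma dual_normM (f : dual X) x : `|f x| <= `|f| * `|x|.
Proof.
have [->|x0] := eqVneq x 0; first by rewrite linear0 !normr0 mulr0.
have nx0 : 0 < `|x| by rewrite normr_gt0.
rewrite -ler_pdivrMr// -[X in X <= _](_ : `|f (`|x|^-1 *: x)| = _).
  by apply: dual_norm_ge; rewrite normrZ normfV normr_id mulVf// gt_eqF.
by rewrite linearZ/= normrZ normfV normr_id mulrC.
Qed.

Lemma pairingDl x x' y : S (x + x') y = S x y + S x' y.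
Proof. by rewrite linearD. Qed.

Lemma pairingDr x y y' : S x (y + y') = S x y + S x y'.
Proof. by rewrite linearD. Qed.

Lemma pairingNl x y : S (- x) y = - S x y.
Proof. by rewrite linearN. Qed.

Lemma pairingNr x y : S x (- y) = - S x y.
Proof. by rewrite linearN. Qed.

Lemma pairingZl a x y : S (a *: x) y = a * S x y.
Proof. by rewrite linearZ. Qed.

Lemma pairingZr a x y : S x (a *: y) = a * S x y.
Proof. by rewrite linearZ. Qed.

Lemma pairing_le (M : R) x y : (forall x, `|S x| <= M * `|x|) ->
  `|S x y| <= M * `|x| * `|y|.
Proof.
by move=> SM; apply: le_trans (dual_normM _ _) _; rewrite ler_wpM2r.
Qed.

Lemma pairing_Cauchy_Schwarz x y : (forall x y, S x y = S y x) ->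
  (forall x, 0 <= S x x) -> S x y ^+ 2 <= S x x * S y y.
Proof.
move=> Ssym S0; set a := S x x; set b := S x y; set c := S y y.
have pos t : 0 <= a + 2 * t * b + t ^+ 2 * c.
  have := S0 (x + t *: y).
  by rewrite pairingDl !pairingDr !pairingZl !pairingZr (Ssym y x) -/a -/b -/c; lra.
have [c0|c0] := eqVneq c 0; last first.
  have cp : 0 < c by rewrite lt_neqAle eq_sym c0 S0.
  (* The minimizer of the quadratic polynomial in [t]. *)
  have := pos (- (b / c)).
  have -> : a + 2 * - (b / c) * b + (- (b / c)) ^+ 2 * c =
      (a * c - b ^+ 2) / c.
    by field.
  by rewrite pmulr_lge0 ?invr_gt0// subr_ge0.
have [->|b0] := eqVneq b 0; first by rewrite expr0n/= mulr_ge0 ?S0.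
(* With [c = 0] the polynomial is affine with nonzero slope; this [t] gives it the value -1. *)
have := pos (- (a + 1) / (2 * b)); rewrite c0.
have -> : a + 2 * (- (a + 1) / (2 * b)) * b + (- (a + 1) / (2 * b)) ^+ 2 * 0 = - 1.
  by field.
lra.
Qed.

End quadratic_form.

(** * A Pitt-type argument: the form is small on far-out vectors *)

Section pitt.
Context {R : realType} {q : R} {q1 : (1 <= q%:E)%E}.
Context (S : {linear ell q1 -> dual (ell q1)}) (M : R).
Context (M0 : 0 < M) (SM : forall x, `|S x| <= M * `|x|).
Context (Ssym : forall x y, S x y = S y x).

(** Induction on [N]: each new block starts beyond the support of the current sum. Disjointness
    makes the $q$-th powers add up, while the form grows by at least [a]. *)
Lemma pairing_disjoint_blocks (a : R) :
  (forall k : nat, exists (v : ell q1) (m : nat), [/\ `|v| <= 1,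
    forall i, (i < k)%N -> v i = 0, forall i, (m <= i)%N -> v i = 0
    & a <= S v v]) ->
  forall N : nat, exists (w : ell q1) (m : nat),
    [/\ forall i, (m <= i)%N -> w i = 0,
      forall n, \sum_(i < n) `|w i| `^ q <= N%:R & N%:R * a <= S w w].
Proof.
move=> blk; have q0 := @ell_exp_gt0 _ _ q1; elim=> [|N [w [m [wm wN aw]]]].
  exists 0, 0%N; split=> // [n|]; last by rewrite mul0r linear0.
  by rewrite big1// => i _; rewrite ell_coord0 normr0 powR0// gt_eqF.
(* The sign of v is chosen so that the cross term S w v is nonnegative. *)
have {blk}[v [m' [v1 vm vm' av swv]]] : exists (v : ell q1) (m' : nat),
    [/\ `|v| <= 1, forall i, (i < m)%N -> v i = 0,
    forall i, (m' <= i)%N -> v i = 0, a <= S v v & 0 <= S w v].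
  have [v [m' [v1 vm vm' av]]] := blk m.
  have [swv|swv] := leP 0 (S w v); first by exists v, m'.
  exists (- v), m'; split.
  - by rewrite normrN.
  - by move=> i /vm; rewrite ell_coordN => ->; rewrite oppr0.
  - by move=> i /vm'; rewrite ell_coordN => ->; rewrite oppr0.
  - by rewrite pairingNl pairingNr opprK.
  - by rewrite pairingNr oppr_ge0 ltW.
exists (w + v), (maxn m m'); split=> [i|n|].
- by rewrite geq_max => /andP[/wm wi /vm' vi]; rewrite ell_coordD wi vi addr0.
- rewrite (eq_bigr (fun i : 'I_n => `|w i| `^ q + `|v i| `^ q)) => [|i _].
    rewrite big_split/= -natr1 lerD ?wN//.
    by have := (ell_normP v _ ler01).1 v1 n; rewrite powR1.
  rewrite ell_coordD; have [im|mi] := ltnP i m.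
    by rewrite (vm _ im) normr0 powR0 ?addr0// gt_eqF.
  by rewrite (wm _ mi) normr0 powR0 ?add0r// gt_eqF.
- rewrite pairingDl !pairingDr (Ssym v w) -natr1 mulrDl mul1r; lra.
Qed.

Context (q2 : 2 < q).

(** Here $q>2$ enters: the left side grows like $N^{2/q}$ with $2/q<1$, so it suffices that
    $N^{1-2/q}>M/a$. *)
Lemma linear_exceeds_powR (a : R) : 0 < a ->
  exists N : nat, M * (N%:R `^ q^-1) ^+ 2 < N%:R * a.
Proof.
move=> a0; have q0 : 0 < q by apply: lt_trans q2.
pose s := 1 - 2 / q; have s0 : 0 < s by rewrite subr_gt0 ltr_pdivrMr ?mul1r.
have [N NM] : exists N : nat, (M / a + 1) `^ s^-1 <= N%:R.
  by exists (Num.truncn ((M / a + 1) `^ s^-1)).+1; exact/ltW/truncnS_gt.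
have Ma0 : 0 < M / a + 1 by rewrite addr_gt0 ?divr_gt0.
have N0 : 0 < N%:R :> R by apply: lt_le_trans NM; exact: powR_gt0.
have Ns : M / a + 1 <= N%:R `^ s.
  have := @ge0_ler_powR _ s (ltW s0) _ _ _ _ NM.
  rewrite -powRrM mulVf ?gt_eqF// powRr1 ?(ltW Ma0)//.
  by apply; rewrite nnegrE ?powR_ge0 ?(ltW N0).
exists N.
have -> : (N%:R `^ q^-1) ^+ 2 = N%:R `^ (2 / q) :> R.
  by rewrite -powR_mulrn ?powR_ge0// -powRrM mulrC.
have NE : N%:R = N%:R `^ s * N%:R `^ (2 / q) :> R.
  rewrite -powRD /s subrK ?powRr1 ?(ltW N0)//.
  by rewrite gt_eqF ?implybT.
rewrite [X in _ < X * _]NE mulrAC ltr_pM2r ?powR_gt0// -ltr_pdivrMr//.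
by apply: lt_le_trans Ns; rewrite ltrDl.
Qed.

(** If this fails, every [k] yields a block with form at least [e / 2]; summing [N] of them violates
    the bound $S(w,w)\le M|w|^2$ for a suitable [N]. *)
Lemma pairing_tail_small (e : R) : 0 < e -> exists k : nat, forall y : ell q1,
  `|y| <= 1 -> (forall i, (i < k)%N -> y i = 0) -> S y y <= e.
Proof.
move=> e0; apply: contrapT => /forallNP Nk.
have [|N Ne] := linear_exceeds_powR (e / 2); first by rewrite divr_gt0.
have [k|w [m [_ wN ew]]] := pairing_disjoint_blocks (e / 2) _ N.
  have /existsNP[y /not_implyP[y1 /not_implyP[yk /negP]]] := Nk k.
  rewrite -ltNge => ey.
  (* Blocks must have finite support, so [y] is truncated. Each of the two error terms in [decomp]
     costs at most [e / 4], leaving more than [e / 2] of the form. *)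
  have [|n yn] := ell_head_cvg y (e / (4 * M)).
    by rewrite divr_gt0// mulr_gt0.
  set v := ell_head n y in yn; exists v, n; split.
  - exact: le_trans (ell_head_le _ _) y1.
  - by move=> i ik; rewrite ell_headE yk//; case: ifP.
  - by move=> i ni; rewrite ell_headE ltnNge ni.
  have v1 : `|v| <= 1 := le_trans (ell_head_le _ _) y1.
  have decomp : S y y = S v v + S (y - v) v + S y (y - v).
    by rewrite pairingDl pairingDr pairingNl pairingNr; lra.
  have e4 : M * (e / (4 * M)) = e / 4 by field; rewrite gt_eqF.
  have b1 : `|S (y - v) v| <= e / 4.
    apply: le_trans (pairing_le S _ _ _ SM) _; rewrite -e4.
    by rewrite -mulrA ler_pM2l// (le_trans _ yn)// ler_piMr.
  have b2 : `|S y (y - v)| <= e / 4.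
    apply: le_trans (pairing_le S _ _ _ SM) _; rewrite -e4.
    by rewrite -mulrA ler_pM2l// (le_trans _ yn)// ler_piMl.
  move: b1 b2; rewrite !ler_norml; lra.
have w1 : `|w| <= N%:R `^ q^-1.
  apply/ell_normP => [|n]; first exact: powR_ge0.
  by rewrite -powRrM mulVf ?powRr1// gt_eqF// (lt_trans _ q2).
have : S w w <= M * (N%:R `^ q^-1) ^+ 2.
  apply: le_trans (le_trans (ler_norm _) (pairing_le S _ _ _ SM)) _.
  by rewrite -mulrA ler_pM2l// expr2 ler_pM.
lra.
Qed.

End pitt.

(** * Uniform boundedness of a frame, and the lower limit *)

Lemma schauder_frame_bounded {R : realType} {X : completeNormedModType R}
    (x : nat -> X) (f : nat -> dual X) :
  schauder_frame x f -> exists C : R, forall n, `|f n| * `|x n| <= C.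
Proof.
(* These rank-one operators have norm [|f n| * |x n|] and are pointwise bounded, being the terms of
   a convergent series. *)
move=> xf; pose T n (y : X) : X := f n y *: x n.
have [] := @Banach_Steinhauss R X X (range T) _ _ 1.
- move=> _ [n _ <-]; split.
    move=> r; exists (`|f n| * r * `|x n|) => y yr.
    rewrite /T normrZ ler_wpM2r//; apply: le_trans (dual_normM _ _) _.
    by rewrite ler_wpM2l.
  by move=> a y z; rewrite /T linearP scalerDl scalerA.
- move=> y; have /cvg_series_cvg_0 Ty0 : cvgn (series (T^~ y)).
    by apply/cvg_ex; exists y; exact: xf.
  have [C [_ yC]] : bounded_fun (T^~ y).
    by apply: cvg_seq_bounded; apply/cvg_ex; exists 0.
  by exists (C + 1) => _ [n _ <-]; apply: yC => //; rewrite ltrDl.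
move=> C TC; exists C => n.
(* Here only $0\le C$ is needed, read off from the bound at the vector 0. *)
have [->|xn0] := eqVneq (x n) 0.
  have := TC _ (ex_intro2 _ _ n I erefl) 0; rewrite normr0 mulr0.
  by move=> /(_ ler01); apply: le_trans.
have xn : 0 < `|x n| by rewrite normr_gt0.
rewrite -ler_pdivlMr//; apply: dual_norm_le => y y1.
rewrite ler_pdivlMr// -normrZ.
exact: TC (ex_intro2 _ _ n I erefl) _ y1.
Qed.

Lemma limn_einf_gt0 {R : realType} (u : nat -> R) :
  (0 < limn_einf (fun n => (u n)%:E))%E ->
  exists2 d : R, 0 < d & exists N, forall n, (N <= n)%N -> d <= u n.
Proof.
(* The lower limit is the supremum of the tail infima, so some tail infimum is positive; it is
   finite, being below [u N]. *)
rewrite limn_einf_lim (cvg_lim _ (@cvg_einfs_sup _ _))//.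
move=> /ereal_sup_gt[_ [N _ <-]] u0.
have uN n : (N <= n)%N -> (einfs (fun n => (u n)%:E) N <= (u n)%:E)%E.
  by move=> Nn; apply: ereal_inf_lbound; exists n.
case: (einfs _ N) u0 uN => [d|_ /(_ N (leqnn _))|]//.
by rewrite lte_fin => d0 dN; exists d => //; exists N => n /dN; rewrite lee_fin.
Qed.

(** * The positive semidefinite form of an HS-frame *)

Section HS_form.
Context {R : realType} {X : normedModType R} (x : nat -> X) (f : nat -> dual X).
Context (S : {linear X -> dual X}) (M : R).
Context (xf : schauder_frame x f) (SM : forall y, `|S y| <= M * `|y|).
Context (Sx : forall n, S (x n) = f n).

(** Apply the bounded operator [S] to the frame expansion of [y] and evaluate at [z]. Symmetry and
    positivity of the form are then visible term by term. *)
Lemma HS_form_series y z :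
  series (fun n => f n y * f n z : R) @ \oo --> (S y z : R).
Proof.
have seriesE n : series (fun n => f n y * f n z : R) n =
    S (series (fun n => f n y *: x n) n) z.
  rewrite !seriesEnat/=; elim: n => [|n ih].
    by rewrite !big_geq// linear0.
  by rewrite !big_nat_recr//= ih linearD/= linearZ/= Sx.
apply/cvgrPdist_lt => e e0 /=.
(* The absolute value and the [+ 1] keep the divisor positive whatever the sign of [M], even for
   [z = 0]. *)
have Mz0 : 0 < `|M| * `|z| + 1 by rewrite ltr_wpDl// mulr_ge0.
have := xf y; move/cvgrPdist_lt/(_ (e / (`|M| * `|z| + 1))).
rewrite divr_gt0// => /(_ isT); apply: filterS => n yn.
rewrite seriesE -pairingNl -pairingDl.
apply: le_lt_trans (pairing_le S M _ _ SM) _.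
rewrite ltr_pdivlMr// in yn; apply: le_lt_trans yn.
rewrite mulrAC mulrC ler_wpM2l//.
by apply: ler_wpDr => //; rewrite ler_wpM2r// ler_norm.
Qed.

Lemma HS_form_sym y z : S y z = S z y.
Proof.
have yz := HS_form_series y z; have zy := HS_form_series z y.
apply: (cvg_unique _ yz) => //.
by rewrite (_ : (fun n => f n y * f n z) = fun n => f n z * f n y)//;
  apply/funext => n; rewrite mulrC.
Qed.

Lemma HS_form_ge0 y : 0 <= S y y.
Proof.
have yy := HS_form_series y y; rewrite -(cvg_lim _ yy)//.
apply: limr_ge; first by apply/cvg_ex; exists (S y y).
apply: nearW => n; rewrite seriesEnat/= sumr_ge0// => i _.
by rewrite -expr2 sqr_ge0.
Qed.

Lemma HS_frame_coeff_cvg0 y : (fun n => f n y : R) @ \oo --> (0 : R).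
Proof.
have /cvg_series_cvg_0 /cvgr0Pnorm_lt y0 : cvgn (series (fun n => f n y * f n y : R)).
  by apply/cvg_ex; exists (S y y); exact: HS_form_series.
apply/cvgr0Pnorm_lt => e e0; have := y0 (e * e) (mulr_gt0 e0 e0).
apply: filterS => n; rewrite normrM; apply: contraTT; rewrite -!leNgt => en.
by rewrite ler_pM// ltW.
Qed.

Context (M0 : 0 < M).

(** For [y] in the unit ball, $f_n(y)^2=S(x_n,y)^2\le S(x_n,x_n)S(y,y)$ by Cauchy-Schwarz, and
    $S(y,y)\le M$. *)
Lemma HS_frame_norm_le n : `|f n| ^+ 2 <= M * S (x n) (x n).
Proof.
have S0 := HS_form_ge0 (x n).
rewrite -(sqr_sqrtr (mulr_ge0 (ltW M0) S0)) ler_sqr ?nnegrE ?sqrtr_ge0//.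
apply: dual_norm_le => y y1; rewrite -sqrtr_sqr ler_wsqrtr//.
rewrite -Sx; apply: le_trans (pairing_Cauchy_Schwarz S _ _ HS_form_sym HS_form_ge0) _.
rewrite mulrC ler_wpM2r//; apply: le_trans (ler_norm _) _.
apply: le_trans (pairing_le S M _ _ SM) _.
by rewrite -mulrA ler_piMr ?(ltW M0)// mulr_ile1.
Qed.

End HS_form.

(** * The contradiction in $\ell_q$ *)

Theorem proposition2p15 (R : realType) (q : R) (q2 : 2 < q) :
  ~ exists (x : nat -> ell (gt2_ge1 q2)) (f : nat -> dual (ell (gt2_ge1 q2))),
      HS_frame x f /\ (0 < limn_einf (fun n => (`|f n|%R)%:E))%E.
Proof.
move=> [x [f [[xf [S [[M' SM'] Sx]]]]]].
move=> /limn_einf_gt0[d d0 [N0 fd]].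
pose M := `|M'| + 1; have M0 : 0 < M by rewrite ltr_wpDl.
have SM y : `|S y| <= M * `|y|.
  apply: le_trans (SM' y) _; rewrite ler_wpM2r//.
  by apply: le_trans (ler_norm _) _; rewrite lerDl.
have Ssym := HS_form_sym x f S M xf SM Sx.
have [C' fxC] := schauder_frame_bounded x f xf.
pose C := `|C'| / d + 1; have C0 : 0 < C by rewrite ltr_wpDl// divr_ge0// ltW.
have xC n : (N0 <= n)%N -> `|x n| <= C.
  move=> /fd dn; apply: (@le_trans _ _ (`|C'| / d)); last by rewrite lerDl.
  rewrite ler_pdivlMr// mulrC; apply: le_trans (ler_wpM2r _ dn) _ => //.
  exact: le_trans (fxC n) (ler_norm _).
(* For large [n], [HS_frame_norm_le] forces $S(x_n,x_n)\ge a$. The contradiction is $S(x_n,x_n)<a$: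
   twice a head term below [a / 3], plus a tail term at most [a / 3]. The factor [C ^+ 2] pays for
   scaling the tail of [x n] into the unit ball. *)
pose a := d ^+ 2 / M; have a0 : 0 < a by rewrite divr_gt0// exprn_gt0.
have [|k tail] := pairing_tail_small S M M0 SM Ssym q2 (a / (3 * C ^+ 2)).
  by rewrite divr_gt0// mulr_gt0// exprn_gt0.
have head0 : \sum_(i < k) `|f n (ell_unit i)| @[n --> \oo] --> (0 : R).
  rewrite [X in _ --> X](_ : _ = \sum_(i < k) `|0 : R|); last first.
    by rewrite big1// => i _; rewrite normr0.
  apply: cvg_big => [|i _]; first exact: add_continuous.
  by apply: cvg_norm; exact: HS_frame_coeff_cvg0 xf SM Sx _.
have [] := @filter_ex _ \oo _ (fun n => (N0 <= n)%N /\
    `|\sum_(i < k) `|f n (ell_unit i)| : R| < a / (3 * C)).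
  apply: filterI; first exact: nbhs_infty_ge.
  by apply: cvgr0_norm_lt head0 _ _; rewrite divr_gt0// mulr_gt0.
move=> n [N0n]; rewrite ger0_norm ?sumr_ge0// => fna.
pose p : ell (gt2_ge1 q2) := ell_head k (x n).
(* From S p p >= 0, with x n split as p + (x n - p). *)
have decomp : S (x n) (x n) <= 2 * S (x n) p + S (x n - p) (x n - p).
  have := HS_form_ge0 x f S M xf SM Sx p.
  by rewrite pairingDl !pairingDr !pairingNl !pairingNr (Ssym p (x n)); lra.
(* The pairing is a combination of the $f_n(e_i)$, $i<k$, whose coefficients are coordinates of
   [x n], hence at most [C] in absolute value. *)
have xp : S (x n) p < a / 3.
  rewrite Sx /p /ell_head linear_sum.
  apply: (@le_lt_trans _ _ (\sum_(i < k) C * `|f n (ell_unit i)|)).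
    apply: ler_sum => i _; rewrite linearZ/=; apply: le_trans (ler_norm _) _.
    rewrite normrM ler_wpM2r//; apply: le_trans (ell_coord_le _ _) (xC _ N0n).
  rewrite -mulr_sumr -ltr_pdivlMl//.
  by have -> : C^-1 * (a / 3) = a / (3 * C) by rewrite mulrCA invfM (mulrC C^-1).
have rr : S (x n - p) (x n - p) <= a / 3.
  have /tail : `|C^-1 *: (x n - p)| <= 1.
    rewrite normrZ gtr0_norm ?invr_gt0// ler_pdivrMl// mulr1.
    exact: le_trans (ell_tail_le _ _) (xC _ N0n).
  rewrite pairingZl pairingZr => /(_ _)/wrap[i ik|].
    by rewrite ell_coordZ ell_tailE ik mulr0.
  rewrite mulrA -invfM -expr2 ler_pdivrMl ?exprn_gt0//.
  by have -> : C ^+ 2 * (a / (3 * C ^+ 2)) = a / 3 by field; rewrite gt_eqF.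
have := HS_frame_norm_le x f S M xf SM Sx M0 n.
have dn : d ^+ 2 <= `|f n| ^+ 2 by rewrite ler_sqr ?nnegrE ?(ltW d0)// fd.
move=> /(le_trans dn); rewrite mulrC -ler_pdivrMr// -/a.
lra.
Qed.
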